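(* Let $n,N\in\mathbb{N}$ and let $\Lambda\subseteq\mathbb{R}^d$ be a Meyer set. Then there exists some $R>0$ such that, for all $x\in\mathbb{R}^d$, the set $\Lambda\cap B_R(x)$ contains a non-trivial and proper $n$-dimensional arithmetic progression of length $N$.
   Context: Here $d\ge 1$ and $B_R(x)$ is the ball of radius $R$ centred at $x$. A set $\Lambda\subseteq\mathbb{R}^d$ is relatively dense if there is $R>0$ such that every ball $B_R(x)$, $x\in\mathbb{R}^d$, contains at least one point of $\Lambda$; it is uniformly discrete if there is $r>0$ such that every ball $B_r(x)$, $x\in\mathbb{R}^d$, contains at most one point of $\Lambda$. A Meyer set is a relatively dense set $\Lambda\subseteq\mathbb{R}^d$ such that $\Lambda-\Lambda$ is uniformly discrete. An $n$-dimensional arithmetic progression of length $N$ is a set $\{s+c_1r_1+\dots+c_nr_n : c_j\in\mathbb{Z},\ 0\le c_j\le N \text{ for all } 1\le j\le n\}$ with $s,r_1,\dots,r_n\in\mathbb{R}^d$; the $r_j$ are called its ratios. It is proper if the elements $s+c_1r_1+\dots+c_nr_n$, $0\le c_j\le N$, are pairwise distinct, and non-trivial if its ratios are non-zero. *)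

(* Defs.v *)
From HB Require Import structures.
From mathcomp Require Export all_boot all_order all_algebra.
From mathcomp Require Export boolp classical_sets functions reals.

Set Implicit Arguments.
Unset Strict Implicit.
Unset Printing Implicit Defensive.

Import Order.TTheory GRing.Theory Num.Theory.
Local Open Scope classical_set_scope.
Local Open Scope ring_scope.

(* R^d is 'rV[R]_d. The norm that MathComp-Analysis puts on row vectors is the
   sup norm, so the Euclidean norm is defined here. *)
Definition enorm (R : realType) (d : nat) (x : 'rV[R]_d) : R :=
  Num.sqrt (\sum_(i < d) x 0 i ^+ 2).

Definition eball (R : realType) (d : nat) (x : 'rV[R]_d) (r : R) :
  set 'rV[R]_d := [set y | enorm (y - x) < r].

Definition relatively_dense (R : realType) (d : nat) (L : set 'rV[R]_d) :=
  exists2 r : R, 0 < r & forall x, (L `&` eball x r) !=set0.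

Definition uniformly_discrete (R : realType) (d : nat) (L : set 'rV[R]_d) :=
  exists2 r : R, 0 < r & forall x, is_subset1 (L `&` eball x r).

Definition difference_set (R : realType) (d : nat) (L : set 'rV[R]_d) :
  set 'rV[R]_d := [set x - y | x in L & y in L].

Definition Meyer_set (R : realType) (d : nat) (L : set 'rV[R]_d) :=
  relatively_dense L /\ uniformly_discrete (difference_set L).

Definition ap_coeffs (n N : nat) : set {ffun 'I_n -> int} :=
  [set c : {ffun _} | forall j, 0 <= c j <= N%:Z].
Arguments ap_coeffs n N : clear implicits.

Definition ap_elt (R : realType) (d n : nat) (s : 'rV[R]_d)
    (r : 'I_n -> 'rV[R]_d) (c : {ffun 'I_n -> int}) : 'rV[R]_d :=
  s + \sum_(j < n) r j *~ c j.

(* With this convention a progression of length N has N + 1 values for each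
   coefficient. *)
Definition ap (R : realType) (d n : nat) (N : nat) (s : 'rV[R]_d)
    (r : 'I_n -> 'rV[R]_d) : set 'rV[R]_d :=
  ap_elt s r @` ap_coeffs n N.

Definition ap_proper (R : realType) (d n : nat) (N : nat) (s : 'rV[R]_d)
    (r : 'I_n -> 'rV[R]_d) :=
  set_inj (ap_coeffs n N) (ap_elt s r).

Definition ap_nontrivial (R : realType) (d n : nat) (r : 'I_n -> 'rV[R]_d) :=
  forall j, r j != 0.

(* Main.v *)
Require Import Defs.
From mathcomp Require Import zify lra.

Set Implicit Arguments.
Unset Strict Implicit.
Unset Printing Implicit Defensive.

(** The statement reduces to one-dimensional progressions, and these come from
    van der Waerden's theorem together with a rounding argument.

    Let [r] be the covering radius of Lambda and let [r1] be the separation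
    scale of Lambda - Lambda. Fix a small vector [v], and for each natural
    number [m] choose a point [lam m] of Lambda within [r] of [x + m v]. The
    error [e m = lam m - (x + m v)] lies in a fixed bounded set, which is cut
    into finitely many cells of diameter less than [r1]; the cell of [e m] is
    the colour of [m] ([finite_coloring]). By van der Waerden's theorem there
    are [a] and [b > 0], bounded independently of [x], such that the numbers
    [a + k b], for [k <= L], have the same colour. The consecutive differences
    [lam (a + (k+1) b) - lam (a + k b)] then belong to Lambda - Lambda and all
    lie within [r1] of the same vector [b v]. Since Lambda - Lambda has at most
    one point in that ball, they are equal: the points [lam (a + k b)], which a
    priori only approximate a progression, form an exact one
    ([long_progression]). Its ratio is nonzero because the coordinates of [v]
    exceed the width of the cells.

    A progression of ratio [rho <> 0] with [(N+1)^n] terms contains an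
    [n]-dimensional one with ratios [(N+1)^j rho], [j < n]. The latter is proper
    because expansions in base [N+1] are unique ([base_expansion_inj]), and it
    stays inside the former because a number with [n] digits in base [N+1] is
    below [(N+1)^n] ([base_expansion_lt]). *)

Import Order.TTheory GRing.Theory Num.Theory.
Local Open Scope classical_set_scope.
Local Open Scope ring_scope.

(** * Van der Waerden's theorem *)

Definition mono_from (C : eqType) (k : nat) (f : nat -> C) (a b : nat) :=
  forall i, (i < k)%N -> f (a + i * b)%N = f a.

(** Colour-focused progressions, the focus being the term [a] before the first
    one rather than the term after the last one: all the monochromatic
    progressions [a + b, a + 2 b, ..., a + k b] extend backwards to [a]. *)
Definition focused (C : eqType) (k : nat) (f : nat -> C) (a : nat)
    (D : seq nat) :=
  uniq [seq f (a + b)%N | b <- D] /\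
  forall b, b \in D -> (0 < b)%N /\ mono_from k f (a + b)%N b.

(** The progression starts at [a + b] so that the term [a] preceding it is again
    a natural number: [color_focusing] uses [a] as a focus. *)
Definition vdW_property (k : nat) := forall C : finType, exists W : nat,
  forall f : nat -> C, exists a b : nat,
    [/\ (a <= W)%N, (0 < b <= W)%N & mono_from k f (a + b)%N b].

(** Induction on [r]. Colour [m] by the whole window of [f] that starts at [m],
    which is again a finite colouring, and take a progression of windows
    [m + b, ..., m + k.+1 b] that look the same. If the window at [m + b]
    contains [r] progressions with steps [c] focused at its entry [a], then the
    steps [c + b], which move diagonally through the windows, and [b], which
    follows the focus itself, are [r.+1] steps focused at [m + a]. The colour
    of the progression of step [b] is that of the focus in the window; if it
    were one of the old colours, the corresponding old progression together
    with its focus would be monochromatic and one term longer. *)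
Lemma color_focusing (k : nat) (C : finType) (r : nat) :
  vdW_property k.+1 -> exists W : nat, forall f : nat -> C,
    (exists a b, [/\ (a <= W)%N, (0 < b <= W)%N & mono_from k.+2 f a b]) \/
    (exists a D, [/\ (a <= W)%N, all (fun b => b <= W)%N D, size D = r
                   & focused k.+1 f a D]).
Proof.
move=> vdWk; elim: r => [|r [W IH]].
  by exists 0%N => f; right; exists 0%N, [::].
(* A window has to hold every [a + i * c] with [a, c <= W] and [i <= k.+1]. *)
pose T := (k.+2 * W).+1.
have [U HU] := vdWk {ffun 'I_T -> C}.
exists (U + U + W)%N => f.
pose F m := [ffun j : 'I_T => f (m + j)%N].
have [m [b [leU /andP[b0 bU] Fm]]] := HU F.
have FE i j : (i <= k)%N -> (j < T)%N ->
    f (m + b + i * b + j)%N = f (m + b + j)%N.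
  move=> ik jT; have /ffunP/(_ (Ordinal jT)) := Fm i ik.
  by rewrite !ffunE.
have [[a [c [aW /andP[c0 cW] Hc]]]|[a [D [aW DW sD [uD HD]]]]] :=
  IH (fun x => f (m + b + x)%N).
  left; exists (m + b + a)%N, c; split; [lia|lia|].
  by move=> i ik; rewrite -addnA Hc.
have [/mapP[c cD cE]|nD] :=
  boolP (f (m + b + a)%N \in [seq f (m + b + (a + c))%N | c <- D]).
  left; exists (m + b + a)%N, c; have [c0 Hc] := HD _ cD.
  have cW := allP DW _ cD; split; [lia|lia|] => -[|i] ik.
    by rewrite mul0n addn0.
  rewrite cE -(Hc i ik); congr f; lia.
right; exists (m + a)%N, (b :: [seq (c + b)%N | c <- D]).
have aT : (a < T)%N by rewrite /T; lia.
split; [lia| |by rewrite /= size_map sD|split].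
- rewrite /=; apply/andP; split; first lia.
  by apply/allP => _ /mapP[c /(allP DW) cW ->]; lia.
- rewrite /= -map_comp (_ : (m + a + b)%N = (m + b + a)%N); last lia.
  by rewrite (eq_map (g := fun c => f (m + b + (a + c))%N)) ?nD //= => c /=;
    congr f; lia.
move=> c; rewrite inE => /orP[/eqP->|/mapP[e eD ->]].
  split=> // i ik.
  have := FE i a ik aT.
  rewrite (_ : (m + a + b + i * b = m + b + i * b + a)%N); last lia.
  by rewrite (_ : (m + a + b = m + b + a)%N) //; lia.
have [e0 He] := HD _ eD; have eW := allP DW _ eD.
split; first lia.
move=> i ik; have jT : (a + e + i * e < T)%N.
  have : (i * e <= k * W)%N by apply: leq_mul.
  by rewrite /T; lia.
rewrite (_ : (m + a + (e + b) + i * (e + b) =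
              m + b + i * b + (a + e + i * e))%N); last lia.
rewrite FE // (He i ik); congr f; lia.
Qed.

(** With one more focused progression than there are colours, the pigeonhole
    principle rules out the second alternative of [color_focusing]. *)
Theorem van_der_Waerden (k : nat) : vdW_property k.
Proof.
elim: k => [|[|k] IH] C; first by exists 1%N => f; exists 0%N, 1%N; split.
  by exists 1%N => f; exists 0%N, 1%N; split=> // -[|i].
have [W HW] := color_focusing C #|C|.+1 IH.
(* Shifting [f] by [W] leaves room for a term before the progression found. *)
exists (W + W)%N => f.
have [[a [b [aW bW Hb]]]|[a [D [_ _ sD [uD _]]]]] := HW (fun x => f (W + x)%N).
  exists (W + a - b)%N, b; split; [lia|lia|] => i ik.
  by rewrite subnK; [rewrite -addnA Hb|lia].
by have := card_uniqP uD; rewrite size_map sD => cD;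
  have := max_card [in [seq f (W + (a + b))%N | b <- D]]; rewrite cD ltnn.
Qed.

(** * Expansions in a given base *)

Lemma base_expansion_lt (B n : nat) (m : 'I_n -> nat) :
  (forall j, m j < B)%N -> (\sum_(j < n) B ^ j * m j < B ^ n)%N.
Proof.
elim: n m => [|n IH] m mB; first by rewrite big_ord0.
rewrite big_ord_recr /= expnSr.
apply: (@leq_trans (B ^ n * (m ord_max).+1)); last by rewrite leq_mul.
rewrite mulnS ltn_add2r.
exact: IH (fun j => mB (widen_ord (leqnSn n) j)).
Qed.

Lemma base_expansion_inj (B n : nat) (m p : 'I_n -> nat) :
  (forall j, m j < B)%N -> (forall j, p j < B)%N ->
  (\sum_(j < n) B ^ j * m j = \sum_(j < n) B ^ j * p j)%N -> m =1 p.
Proof.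
elim: n m p => [|n IH] m p mB pB; first by move=> _ [].
have lowB (q : 'I_n.+1 -> nat) : (\sum_(j < n.+1) B ^ j * q j =
    (\sum_(j < n) B ^ j * q (lift ord0 j)) * B + q ord0)%N.
  rewrite big_ord_recl /= mul1n addnC; congr addn; rewrite big_distrl /=.
  by apply: eq_bigr => j _; rewrite /bump add1n expnS; lia.
rewrite !lowB => E.
have E0 : m ord0 = p ord0.
  by have := congr1 (modn^~ B) E; rewrite !modnMDl !modn_small.
have B0 : (0 < B)%N by apply: leq_ltn_trans (mB ord0).
move: E; rewrite E0 => /addIn/eqP; rewrite eqn_pmul2r // => /eqP /IH E.
move=> j; case: (unliftP ord0 j) => [i|] -> //.
by apply: E => i'.
Qed.

(** * Comparison of the Euclidean norm with coordinates *)

(** The constant [d.+1] is larger than the optimal square root of [d], which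
    makes the inequality strict. *)
Lemma enorm_lt (R : realType) (d : nat) (z : 'rV[R]_d) (B : R) :
  0 < B -> (forall i, `|z 0 i| <= B) -> enorm z < d.+1%:R * B.
Proof.
move=> B0 zB; rewrite /enorm -[ltRHS]ger0_norm; last by rewrite mulr_ge0 ?ltW.
rewrite -sqrtr_sqr ltr_sqrt; last by rewrite exprn_gt0 // mulr_gt0.
apply: (@le_lt_trans _ _ (\sum_(i < d) B ^+ 2)).
  apply: ler_sum => i _; rewrite -(real_normK (num_real (z 0 i))).
  by rewrite lerXn2r ?nnegrE // ltW.
rewrite sumr_const card_ord -[ltLHS]mulr_natl exprMn ltr_pM2r ?exprn_gt0 //.
by rewrite -natrX ltr_nat; lia.
Qed.

Lemma coord_le_enorm (R : realType) (d : nat) (z : 'rV[R]_d) (i : 'I_d) :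
  `|z 0 i| <= enorm z.
Proof.
rewrite -sqrtr_sqr ler_wsqrtr // (bigD1 i) //= lerDl.
by apply: sumr_ge0 => j _; rewrite sqr_ge0.
Qed.

(** * Long progressions in Meyer sets *)

Lemma truncn_eq_close (R : realType) (u v : R) :
  0 <= u -> 0 <= v -> Num.truncn u = Num.truncn v -> `|u - v| < 1.
Proof.
move=> /truncn_itv/andP[lu ul] /truncn_itv/andP[lv vl] E.
by move: lu ul; rewrite E ltr_norml -natr1 in vl *; lra.
Qed.

(** Vectors are coloured by rounding each coordinate down to a multiple of
    [eps]; the shift by [r] makes the rounded numbers natural. *)
Lemma finite_coloring (R : realType) (d : nat) (r eps : R) : 0 < r -> 0 < eps ->
  exists (C : finType) (col : 'rV[R]_d -> C), forall e e',
    enorm e < r -> enorm e' < r -> col e = col e' ->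
    forall i, `|(e - e') 0 i| <= eps.
Proof.
move=> r0 eps0; pose q (e : 'rV[R]_d) i := (e 0 i + r) / eps.
pose M := Num.truncn (2 * r / eps).
exists {ffun 'I_d -> 'I_M.+1}, (fun e => [ffun i => inord (Num.truncn (q e i))]).
have q_ge0 e i : enorm e < r -> 0 <= q e i.
  move=> er; have := le_lt_trans (coord_le_enorm e i) er.
  by rewrite ltr_norml => /andP[? ?]; rewrite divr_ge0 //; lra.
have q_le e i : enorm e < r -> (Num.truncn (q e i) < M.+1)%N.
  move=> er; have := le_lt_trans (coord_le_enorm e i) er.
  rewrite ltr_norml => /andP[? ?]; rewrite ltnS; apply: le_truncn.
  by rewrite ler_pM2r ?invr_gt0 //; lra.
move=> e e' er er' /ffunP E i; have := E i; rewrite !ffunE => /(congr1 val).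
rewrite /= !inordK ?q_le // => /(truncn_eq_close (q_ge0 _ _ er) (q_ge0 _ _ er')).
rewrite /q -mulrBl normrM [X in _ * X]gtr0_norm ?invr_gt0 // ltr_pdivrMr //.
by rewrite mul1r !mxE => /ltW; congr (`|_| <= _); lra.
Qed.

(** Rounding turns a monochromatic progression of indices into an approximate
    progression in Lambda, and uniform discreteness of Lambda - Lambda turns
    approximate into exact. *)
Lemma long_progression (R : realType) (d : nat) (hd : (1 <= d)%N) (L : nat)
    (Lambda : set 'rV[R]_d) (hLambda : Meyer_set Lambda) :
  exists2 rad : R, 0 < rad & forall x : 'rV[R]_d,
    exists s rho : 'rV[R]_d, rho != 0 /\
      forall k, (k < L)%N -> (Lambda `&` eball x rad) (s + rho *+ k).
Proof.
case: hLambda => -[r r0 dense] [r1 r10 discr].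
pose eps : R := r1 / d.+1%:R.
have eps0 : 0 < eps by rewrite divr_gt0.
have r1E : r1 = d.+1%:R * eps by rewrite mulrC divfK // pnatr_eq0.
(* Cells of width [eps / 2] against steps with coordinates [eps]: the first
   coordinate of the ratio is then at least [eps / 2]. *)
have [C [col colP]] := finite_coloring d r0 (divr_gt0 eps0 (ltr0Sn R 1)).
have [W vdW] := van_der_Waerden L.+1 C.
(* The indices below are at most [W + W + L * W]. *)
pose B : R := (L.+2 * W)%:R * eps + r.
have B0 : 0 < B by rewrite ltr_wpDl // mulr_ge0 // ltW.
exists (d.+1%:R * B); first by rewrite mulr_gt0.
move=> x; pose v : 'rV[R]_d := const_mx eps.
have /choice[lam lamP] : forall m : nat, exists l,
  (Lambda `&` eball (x + v *+ m) r) l by move=> m; apply: dense.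
pose e m := lam m - (x + v *+ m).
have er m : enorm (e m) < r by case: (lamP m).
have [a [b [aW /andP[b0 bW] mono]]] := vdW (col \o e).
pose l k := lam (a + b + k * b)%N.
have close k : (k < L)%N ->
    forall i, `|(l k.+1 - l k - v *+ b) 0 i| <= eps / 2.
  move=> kL; rewrite (_ : _ - _ = e (a + b + k.+1 * b)%N - e (a + b + k * b)%N).
    apply: colP => //; have /= -> := mono k.+1 kL.
    by have /= -> := mono k (ltnW kL).
  rewrite /e /l (_ : v *+ (a + b + k.+1 * b) = v *+ (a + b + k * b) + v *+ b).
    move: (v *+ b) (v *+ _) (lam _) (lam _) => t u l' l''.
    by apply/rowP => i; rewrite !mxE; lra.
  by rewrite -mulrnDr; congr (_ *+ _); lia.
have diff k : (k < L)%N ->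
    (difference_set Lambda `&` eball (v *+ b) r1) (l k.+1 - l k).
  move=> kL; split.
    exists (l k.+1); first by case: (lamP (a + b + k.+1 * b)%N).
    by exists (l k); first case: (lamP (a + b + k * b)%N).
  rewrite /eball /= r1E; apply: enorm_lt => // i.
  by apply: le_trans (close k kL i) _; lra.
have step k : (k < L)%N -> l k.+1 - l k = l 1%N - l 0%N.
  move=> kL; have L0 := leq_ltn_trans (leq0n k) kL.
  exact: discr (diff k kL) (diff 0%N L0).
have [->|L0] := posnP L.
  by exists 0, v; split => //; apply/eqP => /rowP/(_ (Ordinal hd));
    rewrite !mxE => E; rewrite E ltxx in eps0.
exists (l 0%N), (l 1%N - l 0%N); split.
  apply/eqP => E; have := close 0%N L0 (Ordinal hd).
  rewrite E sub0r mxE mulmxnE mxE normrN normrMn gtr0_norm //.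
  have : eps *+ 1 <= eps *+ b by rewrite ler_pMn2l.
  by rewrite mulr1n; lra.
have lE k : (k < L)%N -> l 0%N + (l 1%N - l 0%N) *+ k = l k.
  elim: k => [|k IH] kL; first by rewrite mulr0n addr0.
  by rewrite mulrSr addrA IH 1?ltnW // -(step k (ltnW kL)) addrC subrK.
move=> k kL; rewrite lE //; case: (lamP (a + b + k * b)%N) => lamL lamx.
split=> //; apply: enorm_lt => // i.
have := ltW (le_lt_trans (coord_le_enorm _ i) lamx).
rewrite !mxE mulmxnE mxE => H.
set m := (a + b + k * b)%N in H *.
have mW : (m <= L.+2 * W)%N.
  have : (k * b <= L * W)%N by apply: leq_mul => //; apply: ltnW.
  by rewrite /m; lia.
have mE : eps *+ m <= (L.+2 * W)%:R * eps.
  by rewrite -[leLHS]mulr_natl ler_wpM2r ?ler_nat // ltW.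
have m0 : 0 <= eps *+ m by rewrite mulrn_wge0 // ltW.
by rewrite /l -/m; move: H; rewrite /B !ler_norml => /andP[? ?]; apply/andP; lra.
Qed.

Theorem proposition3p3 (R : realType) (d : nat) (hd : (1 <= d)%N) (n N : nat)
    (Lambda : set 'rV[R]_d) (hLambda : Meyer_set Lambda) :
  exists2 rad : R, 0 < rad &
    forall x : 'rV[R]_d,
      exists (s : 'rV[R]_d) (r : 'I_n -> 'rV[R]_d),
        [/\ ap_nontrivial r, ap_proper N s r &
            ap N s r `<=` Lambda `&` eball x rad].
Proof.
have [rad rad0 H] := long_progression hd (N.+1 ^ n) hLambda.
exists rad => // x; have [s [rho [rho0 Hs]]] := H x.
have rho_inj k k' : rho *+ k = rho *+ k' -> k = k'.
  rewrite -!scaler_nat => /eqP; rewrite -subr_eq0 -scalerBl scaler_eq0.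
  by rewrite (negPf rho0) orbF subr_eq0 eqr_nat => /eqP.
exists s, (fun j => rho *+ N.+1 ^ j).
have eltE c : ap_coeffs n N c ->
    ap_elt s (fun j : 'I_n => rho *+ N.+1 ^ j) c
    = s + rho *+ (\sum_(j < n) N.+1 ^ j * `|c j|%N)%N.
  move=> cN; congr (s + _); rewrite -sumrMnr; apply: eq_bigr => j _.
  have /andP[cj0 _] := cN j.
  by rewrite mulrnA (pmulrn _ `|c j|%N) gez0_abs.
have digit c j : ap_coeffs n N c -> (`|c j|%N < N.+1)%N.
  by move=> /(_ j); case: (c j) => // m /andP[].
split.
- move=> j; apply/eqP => /(rho_inj _ 0%N)/eqP.
  by rewrite expn_eq0.
- move=> c c'; rewrite !inE => cN cN'; rewrite !eltE // => /addrI/rho_inj.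
  move=> /base_expansion_inj E; apply/ffunP => j.
  have /andP[cj0 _] := cN j; have /andP[cj0' _] := cN' j.
  rewrite -(gez0_abs cj0) -(gez0_abs cj0'); congr Posz.
  exact: E (fun j => digit c j cN) (fun j => digit c' j cN') j.
- move=> _ [c cN <-]; rewrite eltE //; apply: Hs.
  by apply: base_expansion_lt => j; apply: digit.
Qed.
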